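(* Suppose that $f$ has the MLR property, i.e. $f(x_1-\eta_1)f(x_2-\eta_2)\ge f(x_1-\eta_2)f(x_2-\eta_1)$ whenever $x_1<x_2$ and $\eta_1<\eta_2$; that $W$ satisfies (C1)--(C3) (listed in the context); and that for every fixed $u>0$ and $\theta\ge 0$ the function $$c\mapsto \frac{\int_{-\infty}^{\infty}W(z-c)[f(z-u+\theta)f(z)+f(z-u)f(z+\theta)]\,dz}{\int_{-\infty}^{\infty}[f(z-u+\theta)f(z)+f(z-u)f(z+\theta)]\,dz}$$ has a unique minimizer $c(\theta,u)$, which is the unique solution $c$ of $\int_{-\infty}^{\infty}W'(z-c)[f(z-u+\theta)f(z)+f(z-u)f(z+\theta)]\,dz=0$. In particular, for $u>0$, $c(0,u)$ is the unique solution $c$ of $$\int_{-\infty}^{\infty}W'(z-c)f(z-u)f(z)\,dz=0.$$ Let $\phi:[0,\infty)\to\mathbb{R}$ and $\delta_\phi(\mathbf X)=X_{(2)}-\phi(U)$. If $P_{\boldsymbol\theta}(\phi(U)>c(0,U))>0$ for some $\boldsymbol\theta\in\mathbb{R}^2$, then the estimator $$\delta_{\phi_0}(\mathbf X)=X_{(2)}-\min\{\phi(U),c(0,U)\}$$ improves upon $\delta_\phi$ for estimating $\theta_{(2)}$ under the loss $W(a-\theta_{(2)})$.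
   Context: Setting: $f$ is a Lebesgue probability density on $\mathbb{R}$; $X_1,X_2$ are independent and $X_i$ has density $x\mapsto f(x-\theta_i)$, where $\boldsymbol\theta=(\theta_1,\theta_2)\in\mathbb{R}^2$ is unknown. Write $\theta_{(1)}=\min\{\theta_1,\theta_2\}$, $\theta_{(2)}=\max\{\theta_1,\theta_2\}$, $X_{(1)}=\min\{X_1,X_2\}$, $X_{(2)}=\max\{X_1,X_2\}$, $U=X_{(2)}-X_{(1)}$, $\mathbf X=(X_1,X_2)$. The goal is to estimate $\theta_{(2)}$ under the loss $L(\boldsymbol\theta,a)=W(a-\theta_{(2)})$, $W:\mathbb{R}\to[0,\infty)$; the risk of $\delta$ is $R(\boldsymbol\theta,\delta)=E_{\boldsymbol\theta}[W(\delta(\mathbf X)-\theta_{(2)})]$. Conditions on $W$: (C1) $W(0)=0$, $W$ is strictly decreasing on $(-\infty,0)$ and strictly increasing on $(0,\infty)$; (C2) $W'$ is increasing almost everywhere; (C3) the integrals involving $W$ are finite and differentiation under the integral sign is permissible. ''$\delta'$ improves upon $\delta$'' means $R(\boldsymbol\theta,\delta')\le R(\boldsymbol\theta,\delta)$ for all $\boldsymbol\theta\in\mathbb{R}^2$, with strict inequality for some $\boldsymbol\theta$. *)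

(* Defs.v *)
From HB Require Import structures.
From mathcomp Require Import all_boot all_order all_algebra.
From mathcomp Require Import all_classical all_reals all_analysis.

Set Implicit Arguments.
Unset Strict Implicit.
Unset Printing Implicit Defensive.

Import Order.TTheory GRing.Theory Num.Theory.
Import numFieldNormedType.Exports.

Local Open Scope classical_set_scope.
Local Open Scope ring_scope.

Section Model.
Context {R : realType}.
Local Notation mu := (@lebesgue_measure R).

Definition is_density (f : R -> R) : Prop :=
  [/\ measurable_fun [set: R] f,
      forall x, 0 <= f x
    & (\int[mu]_x (f x)%:E = 1)%E].

Definition MLR (f : R -> R) : Prop :=
  forall x1 x2 eta1 eta2 : R, x1 < x2 -> eta1 < eta2 ->
    f (x1 - eta2) * f (x2 - eta1) <= f (x1 - eta1) * f (x2 - eta2).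

Definition pair_min (x : R * R) : R := Num.min x.1 x.2.
Definition pair_max (x : R * R) : R := Num.max x.1 x.2.
Definition spacing (x : R * R) : R := pair_max x - pair_min x.

(* Under every P theta, X1 and X2 are independent and the i-th one has
   density x |-> f (x - theta_i). *)
Definition location_model d (T : measurableType d) (f : R -> R)
    (P : R * R -> probability T R) (X1 X2 : {mfun T >-> R}) : Prop :=
  forall theta : R * R,
  [/\ forall A B : set R, measurable A -> measurable B ->
        P theta (X1 @^-1` A `&` X2 @^-1` B)
        = (P theta (X1 @^-1` A) * P theta (X2 @^-1` B))%E,
      forall A : set R, measurable A ->
        P theta (X1 @^-1` A) = (\int[mu]_(x in A) (f (x - theta.1))%:E)%E
    & forall A : set R, measurable A ->
        P theta (X2 @^-1` A) = (\int[mu]_(x in A) (f (x - theta.2))%:E)%E].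

Definition risk d (T : measurableType d) (P : R * R -> probability T R)
    (X1 X2 : {mfun T >-> R}) (W : R -> R) (theta : R * R)
    (delta : R * R -> R) : \bar R :=
  ('E_(P theta)[(fun w => W (delta (X1 w, X2 w) - pair_max theta))%R])%E.

Definition improves_upon d (T : measurableType d)
    (P : R * R -> probability T R) (X1 X2 : {mfun T >-> R}) (W : R -> R)
    (delta' delta : R * R -> R) : Prop :=
  (forall theta,
     (risk P X1 X2 W theta delta' <= risk P X1 X2 W theta delta)%E) /\
  (exists theta,
     (risk P X1 X2 W theta delta' < risk P X1 X2 W theta delta)%E).

Definition C1 (W : R -> R) : Prop :=
  [/\ W 0 = 0,
      forall x y, x < y -> y < 0 -> W y < W x
    & forall x y, 0 < x -> x < y -> W x < W y].

(* W' exists and is nondecreasing off a Lebesgue-null set. *)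
Definition C2 (W : R -> R) : Prop :=
  exists2 N : set R, mu.-negligible N &
    (forall x, ~ N x -> derivable W x 1) /\
    (forall x y, ~ N x -> ~ N y -> x <= y -> derive1 W x <= derive1 W y).

(* Unnormalized conditional density of pair_max X - pair_max theta at z given
   spacing X = u, with t = spacing theta. *)
Definition cond_kernel (f : R -> R) (t u z : R) : R :=
  f (z - u + t) * f z + f (z - u) * f (z + t).

(* The part of the third condition that bears on W and f alone; finiteness of
   the risk of a given estimator is [finite_risk]. *)
Definition C3 (f W : R -> R) : Prop :=
  forall t u c : R, 0 <= t -> 0 < u ->
  [/\ mu.-integrable [set: R]
        (fun z => (W (z - c) * cond_kernel f t u z)%:E),
      mu.-integrable [set: R]
        (fun z => (derive1 W (z - c) * cond_kernel f t u z)%:E)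
    & is_derive c 1
        (fun c' => \int[mu]_z (W (z - c') * cond_kernel f t u z))
        (- \int[mu]_z (derive1 W (z - c) * cond_kernel f t u z))].

Definition finite_risk d (T : measurableType d)
    (P : R * R -> probability T R) (X1 X2 : {mfun T >-> R}) (W : R -> R)
    (delta : R * R -> R) : Prop :=
  forall theta, (risk P X1 X2 W theta delta < +oo)%E.

Definition cond_risk (f W : R -> R) (t u c : R) : R :=
  (\int[mu]_z (W (z - c) * cond_kernel f t u z)) /
  (\int[mu]_z (cond_kernel f t u z)).

Definition unique_minimizer (g : R -> R) (m : R) : Prop :=
  (forall x, g m <= g x) /\ (forall y, (forall x, g y <= g x) -> y = m).

Definition unique_zero (g : R -> R) (m : R) : Prop :=
  g m = 0 /\ (forall y, g y = 0 -> y = m).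

Definition delta_phi (phi : R -> R) (x : R * R) : R :=
  pair_max x - phi (spacing x).

End Model.

(* Main.v *)
Require Import Defs.
From HB Require Import structures.
From mathcomp Require Import all_boot all_order all_algebra.
From mathcomp Require Import all_classical all_reals all_analysis.
From mathcomp Require Import measurable_realfun ring lra.
Import Order.TTheory GRing.Theory Num.Theory.
Import numFieldNormedType.Exports.
Local Open Scope classical_set_scope.
Local Open Scope ring_scope.
Set Implicit Arguments.
Unset Strict Implicit.
Unset Printing Implicit Defensive.

(** Put Z = X_(2) - theta_(2), U = X_(2) - X_(1) and t = |theta_1 - theta_2|.
    The pair (Z, U) has density [cond_kernel f t u z] on u > 0, so the risk of
    X_(2) - phi(U) is the integral over u > 0 of G_t(u, phi(u)), where
    G_t(u, a) is the integral of W(z - a) [cond_kernel f t u z] in z.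
    The derivative of G_t(u, .) at a is -H_t(u, a), with W' in place of W, and
    H_t(u, .) is nonincreasing because W' is nondecreasing almost everywhere;
    hence G_t(u, .) is strictly increasing to the right of its minimizer
    c(t, u).  By MLR the ratio [cond_kernel f t u z / cond_kernel f 0 u z] is
    nonincreasing in z, so Chebyshev's inequality gives
    H_t(u, c(0, u)) <= 0, that is c(t, u) <= c(0, u).
    Lowering phi(u) to c(0, u) where it exceeds c(0, u) therefore lowers
    G_t(u, .) strictly, for every t. *)

(** * Lebesgue measure: invariance under shifts and reflections, and integration against a
    density *)

Section Lebesgue.
Context {R : realType}.
Local Notation mu := (@lebesgue_measure R).

(* [lebesgue_measure] lives on [measurableTypeR R], whose display differs from
   the display of [R]. *)
Lemma measurable_shift (a : R) :
  measurable_fun [set: measurableTypeR R] (fun x => x + a : measurableTypeR R).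
Proof. exact: measurable_funD. Qed.

Lemma measurable_reflect (a : R) :
  measurable_fun [set: measurableTypeR R] (fun x => a - x : measurableTypeR R).
Proof. exact: measurable_funB. Qed.

(** The pushforward of [mu] under the shift gives each half-open interval its length, and Lebesgue
    measure is the only measure doing so. The same argument serves for reflections, where []x, y]]
    pulls back to an interval closed at the other end, of equal length. *)
Lemma lebesgue_measure_shift (a : R) (A : set R) : measurable A ->
  mu ((fun x => x + a) @^-1` A) = mu A.
Proof.
move=> mA.
pose m : {measure set (measurableTypeR R) -> \bar R} :=
  measure_function_pushforward__canonical__measure_function_Measure mu (measurable_shift a).
apply/esym; apply: (@lebesgue_measure_unique R m) => // _ [[x y] _ <-] /=.
rewrite /m /= /pushforward.
have -> : (fun z => z + a) @^-1` `]x, y] = `]x - a, y - a]%classic.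
  apply/seteqP; split => z /=; rewrite !in_itv /=; lra.
rewrite !lebesgue_measure_itv /= !lte_fin ltrD2r.
case: ifP => // _; rewrite -!EFinB; congr EFin; ring.
Qed.

Lemma lebesgue_measure_reflect (a : R) (A : set R) : measurable A ->
  mu ((fun x => a - x) @^-1` A) = mu A.
Proof.
move=> mA.
pose m : {measure set (measurableTypeR R) -> \bar R} :=
  measure_function_pushforward__canonical__measure_function_Measure mu (measurable_reflect a).
apply/esym; apply: (@lebesgue_measure_unique R m) => // _ [[x y] _ <-] /=.
rewrite /m /= /pushforward.
have -> : (fun z => a - z) @^-1` `]x, y] = `[a - y, a - x[%classic.
  apply/seteqP; split => z /=; rewrite !in_itv /=; lra.
rewrite !lebesgue_measure_itv /= !lte_fin ltrD2l ltrN2.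
case: ifP => // _; rewrite -!EFinB; congr EFin; ring.
Qed.

Lemma ge0_integral_shift (a : R) (g : R -> \bar R) :
  measurable_fun setT g -> (forall x, 0 <= g x)%E ->
  (\int[mu]_x g (x + a)%R = \int[mu]_x g x)%E.
Proof.
move=> mg g0; have := ge0_integral_pushforward (measurable_shift a) mu measurableT mg.
rewrite preimage_setT => <-; last by move=> y _; exact: g0.
apply: eq_measure_integral => [|? A mA _]; first exact: measurable_shift.
exact: lebesgue_measure_shift.
Qed.

Lemma ge0_integral_reflect (a : R) (g : R -> \bar R) :
  measurable_fun setT g -> (forall x, 0 <= g x)%E ->
  (\int[mu]_x g (a - x)%R = \int[mu]_x g x)%E.
Proof.
move=> mg g0; have := ge0_integral_pushforward (measurable_reflect a) mu measurableT mg.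
rewrite preimage_setT => <-; last by move=> y _; exact: g0.
apply: eq_measure_integral => [|? A mA _]; first exact: measurable_reflect.
exact: lebesgue_measure_reflect.
Qed.

Lemma negligible_shift (a : R) (N : set R) :
  mu.-negligible N -> mu.-negligible [set z | N (z + a)].
Proof.
move=> [B [mB B0 NB]]; exists ((fun z => z + a) @^-1` B); split.
- by rewrite -[X in measurable X]setTI; exact: measurable_shift.
- by rewrite lebesgue_measure_shift.
- by move=> z /NB.
Qed.

(* The density of a law is its Radon-Nikodym derivative almost everywhere. *)
Lemma ge0_integral_density (Q : probability (measurableTypeR R) R) (p : R -> R)
    (h : R -> \bar R) :
  measurable_fun setT p -> (forall x, 0 <= p x) ->
  (forall A, measurable A -> Q A = \int[mu]_(x in A) (p x)%:E)%E ->
  measurable_fun setT h -> (forall x, 0 <= h x)%E ->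
  (\int[Q]_x h x = \int[mu]_x (h x * (p x)%:E))%E.
Proof.
move=> mp p0 Qp mh h0.
have Qmu : Q `<< mu.
  apply/null_content_dominatesP => A mA A0; apply: (eq_trans (Qp A mA)).
  by apply: null_set_integral => //; apply/measurable_EFinP; exact: measurable_funTS.
rewrite -(Radon_Nikodym_SigmaFinite.change_of_variables Qmu)//.
have mRN := measurable_int _ (Radon_Nikodym_SigmaFinite.f_integrable Qmu).
apply: ge0_ae_eq_integral => //.
- exact: emeasurable_funM.
- by apply: emeasurable_funM => //; apply/measurable_EFinP.
- by move=> x _; rewrite mule_ge0// Radon_Nikodym_SigmaFinite.f_ge0.
- by move=> x _; rewrite mule_ge0// lee_fin.
apply: ae_eqe_mul2l; apply: integral_ae_eq => //.
- exact: Radon_Nikodym_SigmaFinite.f_integrable.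
- exact/measurable_EFinP.
- by move=> A _ mA; rewrite -Radon_Nikodym_SigmaFinite.f_integral//; exact: Qp.
Qed.

End Lebesgue.

(** * The joint law of the two observations *)

Section JointLaw.
Context {R : realType} {d : measure_display} {T : measurableType d}.
Variables (f : R -> R) (P : R * R -> probability T R) (X1 X2 : {mfun T >-> R}).
Hypotheses (f_density : is_density f) (model : location_model f P X1 X2).
Local Notation mu := (@lebesgue_measure R).

(** Independence fixes the law of the pair on rectangles, so it is the product of the marginal laws.
    Tonelli and the density of each marginal then give the iterated integral. *)
Lemma integral_location_model (theta : R * R) (h : R * R -> \bar R) :
  measurable_fun [set: measurableTypeR R * measurableTypeR R] h -> (forall x, 0 <= h x)%E ->
  (\int[P theta]_w h (X1 w, X2 w) =
   \int[mu]_x \int[mu]_y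
     (h (x, y) * (f (x - theta.1) * f (y - theta.2))%:E))%E.
Proof.
move=> mh h0; have [mf f0 _] := f_density; have [ind law1 law2] := model theta.
pose M := measurableTypeR R.
have mX1 : measurable_fun (U := M) setT X1 := measurable_funP X1.
have mX2 : measurable_fun (U := M) setT X2 := measurable_funP X2.
(* [Y1] and [Y2] are [X1] and [X2] with codomain [M], the type on which [mu] lives. *)
pose Y1 : {mfun T >-> M} := HB.pack (X1 : T -> M) (isMeasurableFun.Build _ _ _ _ _ mX1).
pose Y2 : {mfun T >-> M} := HB.pack (X2 : T -> M) (isMeasurableFun.Build _ _ _ _ _ mX2).
pose Q1 := distribution (P theta) Y1; pose Q2 := distribution (P theta) Y2.
have mX : measurable_fun setT (fun w => (Y1 w, Y2 w)) by exact: measurable_fun_pair.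
pose m := measure_function_pushforward__canonical__measure_function_Measure (P theta) mX.
have mfs b : measurable_fun [set: M] (fun x : M => f (x - b)).
  by apply: measurableT_comp => //; exact: measurable_shift.
have := ge0_integral_pushforward mX (P theta) measurableT mh.
rewrite preimage_setT => <-; last by move=> y _; exact: h0.
transitivity (\int[(Q1 \x Q2)%E]_z h z)%E.
  apply: eq_measure_integral => A mA _; apply/esym.
  by apply: (@product_measure_unique _ _ _ _ _ Q1 Q2 m) => // B C mB mC; exact: ind.
rewrite (@fubini_tonelli1 _ _ M M R Q1 Q2 h mh h0) /fubini_F.
rewrite (@ge0_integral_density R Q1 (fun x => f (x - theta.1)))//; first last.
- by move=> x; exact: integral_ge0.
- exact: (measurable_fun_fubini_tonelli_F _ mh).
- exact: mfs.
apply: eq_integral => x _.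
rewrite (@ge0_integral_density R Q2 (fun x => f (x - theta.2)))//; first last.
- exact: (measurableT_comp mh).
- exact: mfs.
rewrite muleC -ge0_integralZl//.
- by apply: eq_integral => y _; rewrite EFinM muleCA.
- apply: emeasurable_funM; first exact: (measurableT_comp mh).
  apply/measurable_EFinP; exact: mfs.
- by move=> y _; rewrite mule_ge0// lee_fin.
- by rewrite lee_fin.
Qed.

End JointLaw.

(** * Change of variables to the maximum and the spacing *)

Section Spacing.
Context {R : realType}.
Local Notation mu := (@lebesgue_measure R).
Let M := measurableTypeR R.

Lemma tonelli (F : R * R -> \bar R) :
  measurable_fun [set: M * M] F -> (forall x, 0 <= F x)%E ->
  (\int[mu]_x \int[mu]_y F (x, y) = \int[mu]_y \int[mu]_x F (x, y))%E.
Proof. exact: (@fubini_tonelli _ _ M M R mu mu F). Qed.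

Lemma ge0_integral_lebesgueD (g h : M -> \bar R) :
  measurable_fun [set: M] g -> measurable_fun [set: M] h ->
  (forall x, 0 <= g x)%E -> (forall x, 0 <= h x)%E ->
  (\int[mu]_x (g x + h x) = \int[mu]_x g x + \int[mu]_x h x)%E.
Proof.
by move=> mg mh g0 h0; exact: (ge0_integralD mu measurableT (fun x _ => g0 x) mg
  (fun x _ => h0 x) mh).
Qed.

(** The plane is cut along the diagonal. On each side [z] is the larger coordinate and [z - u] the
    smaller one. After Tonelli the substitution is a reflection in one variable, so no planar
    Jacobian enters. *)
Lemma integral_spacing_split (F : R * R -> \bar R) :
  measurable_fun [set: M * M] F -> (forall x, 0 <= F x)%E ->
  (\int[mu]_x \int[mu]_y F (x, y) =
   \int[mu]_(u in `]0%R, +oo[) \int[mu]_z (F (z, z - u)%R + F (z - u, z)%R))%E.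
Proof.
move=> mF F0.
(* [F2] keeps the diagonal. *)
pose F1 p := if p.2 < p.1 then F p else 0%E.
pose F2 p := if p.2 < p.1 then 0%E else F p.
have mlt : measurable_fun [set: M * M] (fun p : M * M => p.2 < p.1).
  by apply: (@measurable_fun_ltr _ (M * M)%type R).
have mF1 : measurable_fun [set: M * M] F1 by exact: measurable_fun_ifT.
have mF2 : measurable_fun [set: M * M] F2 by exact: measurable_fun_ifT.
have F10 p : (0 <= F1 p)%E by rewrite /F1; case: ifP.
have F20 p : (0 <= F2 p)%E by rewrite /F2; case: ifP.
have FE p : F p = (F1 p + F2 p)%E.
  by rewrite /F1 /F2; case: ifP; rewrite ?adde0 ?add0e.
have mB : measurable_fun [set: M * M] (fun p : M * M => (p.2 - p.1 : M)).
  by apply: (@measurable_funB _ (M * M)%type R).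
have mG1 : measurable_fun [set: M * M] (fun p : M * M => F1 (p.2, p.2 - p.1)).
  by apply: (measurableT_comp mF1); exact: measurable_fun_pair.
have mG2 : measurable_fun [set: M * M] (fun p : M * M => F2 (p.2 - p.1, p.2)).
  by apply: (measurableT_comp mF2); exact: measurable_fun_pair.
have mH1 : measurable_fun [set: M * M] (fun p : M * M => F (p.2, p.2 - p.1)).
  by apply: (measurableT_comp mF); exact: measurable_fun_pair.
have mH2 : measurable_fun [set: M * M] (fun p : M * M => F (p.2 - p.1, p.2)).
  by apply: (measurableT_comp mF); exact: measurable_fun_pair.
have E1 : (\int[mu]_x \int[mu]_y F1 (x, y) =
           \int[mu]_u \int[mu]_z F1 (z, z - u)%R)%E.
  have /= -> := tonelli mG1 (fun p => F10 _).
  apply: eq_integral => x _; rewrite (@ge0_integral_reflect R x (fun y => F1 (x, y))) //.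
  exact: (measurableT_comp mF1).
have E2 : (\int[mu]_x \int[mu]_y F2 (x, y) =
           \int[mu]_u \int[mu]_z F2 (z - u, z)%R)%E.
  have /= -> := tonelli mG2 (fun p => F20 _); rewrite (tonelli mF2 F20).
  apply: eq_integral => y _; rewrite (@ge0_integral_reflect R y (fun x => F2 (x, y)))//.
  exact: (measurableT_comp mF2).
have msec (H : M * M -> \bar R) x : measurable_fun [set: M * M] H ->
    measurable_fun [set: M] (fun y => H (x, y)).
  by move=> mH; exact: (measurableT_comp mH (pair1_measurable x)).
have mint (H : M * M -> \bar R) : measurable_fun [set: M * M] H ->
    (forall p, 0 <= H p)%E -> measurable_fun [set: M] (fun x => \int[mu]_y H (x, y))%E.
  by move=> mH H0; exact: (measurable_fun_fubini_tonelli_F H mH H0).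
transitivity (\int[mu]_x (\int[mu]_y F1 (x, y) + \int[mu]_y F2 (x, y)))%E.
  apply: eq_integral => x _; under eq_integral do rewrite FE.
  exact: (ge0_integral_lebesgueD (msec _ x mF1) (msec _ x mF2) (fun=> F10 _) (fun=> F20 _)).
have int0 (H : M * M -> \bar R) : (forall p, 0 <= H p)%E ->
    forall x, (0 <= \int[mu]_y H (x, y))%E.
  by move=> H0 x; apply: integral_ge0 => y _; exact: H0.
rewrite (ge0_integral_lebesgueD (mint _ mF1 F10) (mint _ mF2 F20) (int0 _ F10) (int0 _ F20)).
rewrite E1 E2 -(ge0_integral_lebesgueD (mint _ mG1 (fun=> F10 _)) (mint _ mG2 (fun=> F20 _))
  (int0 _ (fun=> F10 _)) (int0 _ (fun=> F20 _))) /=.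
have mK : measurable_fun [set: M] (fun u => \int[mu]_z (F (z, z - u)%R + F (z - u, z)%R))%E.
  exact: (mint _ (emeasurable_funD mH1 mH2) (fun=> adde_ge0 (F0 _) (F0 _))).
have m0 : measurable (`]0%R, +oo[%classic : set M) by exact: measurable_itv.
rewrite [RHS]integral_mkcond; apply: ge0_ae_eq_integral; first exact: measurableT.
- exact: (emeasurable_funD (mint _ mG1 (fun=> F10 _)) (mint _ mG2 (fun=> F20 _))).
- by apply/(measurable_restrictT _ m0); exact: measurable_funTS.
- by move=> u _; apply: adde_ge0; apply: integral_ge0 => z _; [exact: F10|exact: F20].
- move=> u _; rewrite /patch; case: ifP => _; last exact: lexx.
  by apply: integral_ge0 => z _; rewrite adde_ge0.
(* The integrands can differ only at [u = 0], where [F2] carries the diagonal but the right side is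
   cut to [u > 0]. For [u < 0] both sides vanish. *)
exists [set 0%R]; split; [exact: measurable_set1|exact: lebesgue_measure_set1|].
move=> u /= /not_implyP[_ uE]; apply: contrapT => u0; apply: uE.
rewrite /patch -(ge0_integral_lebesgueD (msec _ u mG1) (msec _ u mG2)
  (fun=> F10 _) (fun=> F20 _)) /=.
case: ifPn => [|]; rewrite ?inE ?notin_setE /= in_itv /= andbT => u_gt0.
  apply: eq_integral => z _; rewrite /F1 /F2 /=.
  by rewrite gtrBl u_gt0 ltrBrDr gtrDl ltNge (ltW u_gt0).
have {}u_gt0 : u < 0.
  have /eqP : (u : R) <> 0 by [].
  by rewrite neq_lt => /orP[|/u_gt0].
apply: integral0_eq => z _; rewrite /F1 /F2 /=.
by rewrite gtrBl ltNge (ltW u_gt0) /= ltrBrDr gtrDl u_gt0 adde0.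
Qed.

(** The two halves of the plane yield the two summands of [cond_kernel]: in one, the observation
    with the larger parameter is the maximum, in the other the minimum. *)
Lemma integral_location_spacing d (T : measurableType d) (f : R -> R)
    (P : R * R -> probability T R) (X1 X2 : {mfun T >-> R}) (theta : R * R)
    (h : R * R -> \bar R) :
  is_density f -> location_model f P X1 X2 ->
  measurable_fun [set: M * M] h -> (forall x, 0 <= h x)%E ->
  (\int[P theta]_w
      h (pair_max (X1 w, X2 w) - pair_max theta, spacing (X1 w, X2 w))%R =
   \int[mu]_(u in `]0%R, +oo[) \int[mu]_z
      (h (z, u) * (cond_kernel f (spacing theta) u z)%:E))%E.
Proof.
move=> fd model mh h0; have [mf f0 _] := fd.
set m := pair_max theta.
pose F p := (h (pair_max p - m, spacing p)%R *
             (f (p.1 - theta.1) * f (p.2 - theta.2))%:E)%E.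
have mmax : measurable_fun [set: M * M] (@pair_max R).
  exact: (@measurable_maxr _ (M * M)%type R).
have mmin : measurable_fun [set: M * M] (@pair_min R).
  exact: (@measurable_minr _ (M * M)%type R).
have mhs : measurable_fun [set: M * M] (fun p : M * M => h (pair_max p - m, spacing p)).
  apply: (measurableT_comp mh); apply: measurable_fun_pair.
    exact: (@measurable_funB _ (M * M)%type R).
  exact: (@measurable_funB _ (M * M)%type R).
have mf' : measurable_fun [set: M] (fun x : M => f x : M) by exact: mf.
have mF : measurable_fun [set: M * M] F.
  apply: emeasurable_funM => //; apply/measurable_EFinP.
  apply: (@measurable_funM _ (M * M)%type R).
    apply: (measurableT_comp mf'); exact: (@measurable_funB _ (M * M)%type R).
  apply: (measurableT_comp mf'); exact: (@measurable_funB _ (M * M)%type R).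
have F0 p : (0 <= F p)%E by rewrite mule_ge0// lee_fin mulr_ge0.
have -> := integral_location_model fd model theta mhs (fun=> h0 _).
rewrite (integral_spacing_split mF F0).
apply: eq_integral => u; rewrite inE /= in_itv /= andbT => u0.
(* Shifting by [m] makes [z] the deviation of the maximum from the larger parameter. *)
rewrite -(@ge0_integral_shift R m); last 2 first.
- apply: emeasurable_funD.
  + apply: (measurableT_comp mF); apply: measurable_fun_pair => //.
    exact: (@measurable_funB _ M R).
  + apply: (measurableT_comp mF); apply: measurable_fun_pair => //.
    exact: (@measurable_funB _ M R).
- by move=> z; rewrite adde_ge0.
apply: eq_integral => z _; rewrite /F /spacing /pair_max /pair_min /=.
have le1 : z + m - u <= z + m by lra.
rewrite (max_l le1) (max_r le1) (min_l le1) (min_r le1).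
have -> : z + m - m = z by ring.
have -> : z + m - (z + m - u) = u by ring.
rewrite -ge0_muleDr ?lee_fin ?mulr_ge0// -EFinD; congr (_ * _%:E)%E.
rewrite /m /cond_kernel /pair_max; have [le12|/ltW le21] := leP theta.1 theta.2.
  have -> : z + theta.2 - theta.1 = z + (theta.2 - theta.1) by ring.
  have -> : z + theta.2 - u - theta.2 = z - u by ring.
  have -> : z + theta.2 - u - theta.1 = z - u + (theta.2 - theta.1) by ring.
  have -> : z + theta.2 - theta.2 = z by ring.
  by rewrite addrC; congr (_ + _); ring.
have -> : z + theta.1 - theta.2 = z + (theta.1 - theta.2) by ring.
have -> : z + theta.1 - u - theta.1 = z - u by ring.
have -> : z + theta.1 - u - theta.2 = z - u + (theta.1 - theta.2) by ring.
have -> : z + theta.1 - theta.1 = z by ring.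
by congr (_ + _); ring.
Qed.
End Spacing.

(** * The conditional loss as a function of the shift, and its minimizer *)

Section RiskProfile.
Context {R : realType}.
Local Notation mu := (@lebesgue_measure R).
Local Notation M := (measurableTypeR R).

(** Off [N], [g] coincides with its absolute value, so both have the same integral. This form suits
    [C2], which orders the values of [W'] only off a null set. *)
Lemma ae_ge0_Rintegral (N : set R) (g : R -> R) : mu.-negligible N ->
  mu.-integrable [set: M] (EFin \o g) -> (forall x, ~ N x -> 0 <= g x) ->
  0 <= \int[mu]_x g x.
Proof.
move=> [B [mB B0 NB]] ig g0.
have mg : measurable_fun [set: M] (g : M -> R) by apply/measurable_EFinP; exact: measurable_int ig.
have -> : \int[mu]_x g x = \int[mu]_x `|g x|; last by apply: Rintegral_ge0.
congr fine; apply: ae_eq_integral; [by []|exact/measurable_EFinP| |].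
  by apply/measurable_EFinP; exact: (measurableT_comp (@normr_measurable R setT)).
exists B; split => // x /= /not_implyP[_ gx]; apply: NB; apply: contrapT => /g0 gx0.
by apply: gx; rewrite ger0_norm.
Qed.

Lemma integrable_lin2 (r s : R) (g h : R -> R) :
  mu.-integrable [set: M] (EFin \o g) -> mu.-integrable [set: M] (EFin \o h) ->
  mu.-integrable [set: M] (EFin \o (fun x => r * g x + s * h x)).
Proof.
move=> ig ih.
exact: (integrableD measurableT (integrableZl measurableT r ig)
                                (integrableZl measurableT s ih)).
Qed.

Lemma Rintegral_lin2 (r s : R) (g h : R -> R) :
  mu.-integrable [set: M] (EFin \o g) -> mu.-integrable [set: M] (EFin \o h) ->
  \int[mu]_x (r * g x + s * h x) = r * \int[mu]_x g x + s * \int[mu]_x h x.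
Proof.
move=> ig ih; rewrite -!RintegralZl//.
rewrite RintegralD//.
  exact: (integrableZl measurableT r ig).
exact: (integrableZl measurableT s ih).
Qed.

(* Integrating the nonnegative cross product
   [(psi y - psi x) (q x p y - q y p x)] over [y], then over [x]. *)
Lemma chebyshev_likelihood_ratio (N : set R) (psi p q : R -> R) :
  mu.-negligible N ->
  (forall x y, ~ N x -> ~ N y -> x <= y -> psi x <= psi y) ->
  (forall x y, x < y -> q y * p x <= q x * p y) ->
  mu.-integrable [set: M] (EFin \o p) -> mu.-integrable [set: M] (EFin \o q) ->
  mu.-integrable [set: M] (EFin \o (fun x => psi x * p x)) ->
  mu.-integrable [set: M] (EFin \o (fun x => psi x * q x)) ->
  (\int[mu]_x (psi x * q x)) * (\int[mu]_x p x) <=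
  (\int[mu]_x (psi x * p x)) * (\int[mu]_x q x).
Proof.
move=> negN psi_nd pq ip iq ipsip ipsiq.
set B := \int[mu]_x (psi x * q x); set A := \int[mu]_x (psi x * p x).
set Kp := \int[mu]_x p x; set Kq := \int[mu]_x q x.
(* This is the cross product integrated over [y]; the factors [1 *] and the signs match the shape of
   [Rintegral_lin2]. *)
have inner x : ~ N x ->
    0 <= 1 * (q x * A + - p x * B) + 1 * (- (psi x * q x) * Kp + psi x * p x * Kq).
  move=> Nx.
  rewrite /A /B /Kp /Kq -!Rintegral_lin2 //; try exact: integrable_lin2.
  apply: (ae_ge0_Rintegral negN) => [|y Ny].
    by do 2?apply: integrable_lin2.
  have -> : 1 * (q x * (psi y * p y) + - p x * (psi y * q y)) +
      1 * (- (psi x * q x) * p y + psi x * p x * q y) =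
      (psi y - psi x) * (q x * p y - q y * p x) by ring.
  have [xy|yx|->] := ltgtP x y; last by rewrite subrr mul0r.
    by rewrite mulr_ge0// subr_ge0; [exact: psi_nd (ltW xy)|exact: pq].
  rewrite -mulrNN !opprB mulr_ge0// subr_ge0; first exact: psi_nd (ltW yx).
  exact: pq.
(* Integrating over [x] as well gives twice [A * Kq - B * Kp]. *)
suff : 0 <= 1 * (A * Kq + - B * Kp) + 1 * (- Kp * B + Kq * A) by lra.
rewrite {2}/A {2}/B {1}/Kp {1}/Kq -!Rintegral_lin2 //; try exact: integrable_lin2.
apply: (ae_ge0_Rintegral negN) => [|x Nx].
  by do 2?apply: integrable_lin2.
by have := inner x Nx; lra.
Qed.

Lemma cond_kernel_ge0 (f : R -> R) (t u z : R) :
  (forall x, 0 <= f x) -> 0 <= cond_kernel f t u z.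
Proof. by move=> f0; rewrite addr_ge0// mulr_ge0. Qed.

Lemma measurable_cond_kernel (f : R -> R) (t u : R) :
  measurable_fun [set: R] f -> measurable_fun [set: M] (cond_kernel f t u).
Proof.
move=> mf.
have mfs a : measurable_fun [set: M] (fun z : M => f (z + a)).
  exact: (measurableT_comp (f := f : M -> M) mf (measurable_shift a)).
apply: (@measurable_funD _ M R); apply: (@measurable_funM _ M R) => //.
have -> : (fun z => f (z - u + t)) = (fun z => f (z + (t - u))).
  by apply/funext => z; congr f; ring.
exact: mfs.
Qed.

(** Where [f] is positive, the ratio of the kernels at [t] and at [0] is half of [f (z - u + t) / f
    (z - u) + f (z + t) / f z], and MLR makes both terms nonincreasing in [z]. The cross-multiplied
    form allows [f] to vanish. The case [t = 0] is separate because [MLR] compares distinct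
    parameters. *)
Lemma cond_kernel_MLR (f : R -> R) (t u x y : R) :
  (forall x, 0 <= f x) -> MLR f -> 0 <= t -> x < y ->
  cond_kernel f t u y * cond_kernel f 0 u x <=
  cond_kernel f t u x * cond_kernel f 0 u y.
Proof.
move=> f0 f_MLR; rewrite le_eqVlt => /predU1P[<- _|t0 xy]; first by rewrite mulrC.
have key a b : a < b -> f (b + t) * f a <= f (a + t) * f b.
  move=> ab; have := f_MLR (a + t) (b + t) 0 t.
  by rewrite !subr0 !addrK ltrD2r mulrC => ->.
have h1 := key x y xy.
have h2 : f (y - u + t) * f (x - u) <= f (x - u + t) * f (y - u) by apply: key; lra.
rewrite /cond_kernel !addr0.
have := lerD (ler_wpM2l (mulr_ge0 (f0 x) (f0 y)) h2)
             (ler_wpM2l (mulr_ge0 (f0 (x - u)) (f0 (y - u))) h1).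
lra.
Qed.

Variables (f W : R -> R).
Hypotheses (f_density : is_density f) (W_C2 : C2 W) (W_C3 : C3 f W).

Local Notation G t u := (fun a => \int[mu]_z (W (z - a) * cond_kernel f t u z)).
Local Notation H t u :=
  (fun a => \int[mu]_z (derive1 W (z - a) * cond_kernel f t u z)).

(* If the normalizing integral were [0] or infinite, then [cond_risk] would be
   constant, because [x / 0 = 0] and [fine +oo = 0]. *)
Lemma cond_kernel_normalizable (t u m : R) :
  unique_minimizer (cond_risk f W t u) m ->
  mu.-integrable [set: M] (EFin \o cond_kernel f t u) /\
  0 < \int[mu]_z cond_kernel f t u z.
Proof.
have [mf f0 _] := f_density; move=> [_ uniq].
have K0 : \int[mu]_z cond_kernel f t u z != 0.
  apply/eqP => K0; have : m + 1 = m; last lra.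
  by apply: uniq => x; rewrite /cond_risk K0 invr0 !mulr0.
split; last first.
  by rewrite lt_neqAle eq_sym K0/= Rintegral_ge0// => z _; exact: cond_kernel_ge0.
apply/integrableP; split; first by apply/measurable_EFinP; exact: (measurable_cond_kernel t u mf).
under eq_integral do rewrite /= ger0_norm ?cond_kernel_ge0//.
rewrite ltey; apply/eqP => Ky; move: K0.
by rewrite /Rintegral Ky eqxx.
Qed.

(** The difference of the integrands is nonnegative unless [z - a] or [z - b] falls in the null set
    of [C2], that is, off two shifted null sets. *)
Lemma score_nonincreasing (t u a b : R) : 0 <= t -> 0 < u -> a <= b ->
  H t u b <= H t u a.
Proof.
move=> t0 u0 ab; have [_ f0 _] := f_density; have [N negN [_ W'_nd]] := W_C2.
have [_ ia _] := W_C3 a t0 u0; have [_ ib _] := W_C3 b t0 u0.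
rewrite -subr_ge0 -RintegralB//.
apply: (ae_ge0_Rintegral (negligibleU (negligible_shift (- a) negN)
                                      (negligible_shift (- b) negN))).
  exact: (integrableB measurableT ia ib).
move=> z /not_orP[/= Na Nb].
rewrite -mulrBl mulr_ge0 ?cond_kernel_ge0// subr_ge0 W'_nd//.
by rewrite lerD2l lerN2.
Qed.

Lemma cond_loss_MVT (t u a b : R) : 0 <= t -> 0 < u -> a < b ->
  exists2 x, a < x < b & G t u b - G t u a = - H t u x * (b - a).
Proof.
move=> t0 u0 ab.
have dG (x : R) : is_derive x 1 (G t u) (- H t u x) by have [] := W_C3 x t0 u0.
have [|x xab E] := MVT ab (fun x _ => dG x).
  by apply: derivable_within_continuous => x _; have [] := dG x.
by exists x => //; move: xab; rewrite in_itv.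
Qed.

(** At the mean value point, which lies to the right of [m], [H] is at most [H m = 0] by
    monotonicity and nonzero by uniqueness of the zero. Hence the slope [- H] is strictly
    positive. *)
Lemma cond_loss_increasing (t u m a b : R) : 0 <= t -> 0 < u ->
  unique_zero (H t u) m -> m <= a -> a < b -> G t u a < G t u b.
Proof.
move=> t0 u0 [Hm uniq] ma ab.
have [x /andP[ax xb] E] := cond_loss_MVT t0 u0 ab.
have mx : m < x := le_lt_trans ma ax.
rewrite -subr_gt0 E mulr_gt0 ?subr_gt0// oppr_gt0 lt_neqAle.
rewrite -[X in _ <= X]Hm score_nonincreasing ?(ltW mx)// andbT.
by apply/eqP => /uniq xm; rewrite xm ltxx in mx.
Qed.

Lemma cond_loss_nonincreasing (t u m a b : R) : 0 <= t -> 0 < u ->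
  unique_zero (H t u) m -> a < b -> b <= m -> G t u b <= G t u a.
Proof.
move=> t0 u0 [Hm _] ab bm.
have [x /andP[ax xb] E] := cond_loss_MVT t0 u0 ab.
rewrite -subr_le0 E mulNr oppr_le0 mulr_ge0 ?subr_ge0 ?(ltW ab)//.
by rewrite -[X in X <= _]Hm score_nonincreasing// (ltW (lt_le_trans xb bm)).
Qed.

(** Chebyshev's inequality at [m0], with [W'] shifted by [m0], gives [H_t(m0) <= 0]. The two
    minimizer hypotheses supply the integrability of the kernels and the positive mass of the one at
    [0]. *)
Lemma optimal_shift_le (t u m m0 m1 m2 : R) : MLR f -> 0 <= t -> 0 < u ->
  unique_minimizer (cond_risk f W t u) m1 ->
  unique_minimizer (cond_risk f W 0 u) m2 ->
  unique_zero (H t u) m -> unique_zero (H 0 u) m0 -> m <= m0.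
Proof.
move=> f_MLR t0 u0 min_t min_0 [Hm uniq] [Hm0 _].
have [_ f0 _] := f_density; have [N negN [_ W'_nd]] := W_C2.
have [iKt _] := cond_kernel_normalizable min_t.
have [iK0 K0] := cond_kernel_normalizable min_0.
have [_ it _] := W_C3 m0 t0 u0; have [_ i0 _] := W_C3 m0 (lexx 0) u0.
have Ht : H t u m0 <= 0.
  rewrite -(pmulr_lle0 _ K0).
  have := chebyshev_likelihood_ratio (N := [set z | N (z + - m0)])
    (psi := fun z => derive1 W (z - m0)) (p := cond_kernel f 0 u)
    (q := cond_kernel f t u).
  rewrite Hm0 mul0r; apply => //.
  - exact: negligible_shift.
  - by move=> x y Nx Ny xy; apply: W'_nd => //; rewrite lerD2r.
  - by move=> x y xy; exact: cond_kernel_MLR.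
(* If [m0 < m], monotonicity also gives [H_t(m0) >= H_t(m) = 0], so [m0] would be a second zero. *)
rewrite leNgt; apply/negP => m0m.
have Ht0 : H t u m0 = 0.
  by apply/eqP; rewrite eq_le Ht -[X in X <= _]Hm score_nonincreasing// ltW.
by rewrite (uniq _ Ht0) ltxx in m0m.
Qed.

End RiskProfile.

(** * Measurability, and the risk as an integral over the spacing *)

Section Risk.
Context {R : realType}.
Local Notation mu := (@lebesgue_measure R).
Local Notation M := (measurableTypeR R).
Local Notation pos := (`]0%R, +oo[%classic : set M).

(** Since [W 0 = 0], [W] is the sum of its restrictions to the two half-lines, each extended by 0.
    One is nonincreasing and the other nondecreasing, hence both are measurable. *)
Lemma measurable_loss (W : R -> R) : (forall x, 0 <= W x) -> C1 W ->
  measurable_fun [set: M] (W : M -> M).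
Proof.
move=> W0 [W00 Wdecr Wincr].
have -> : W = (fun x => W (Num.min x 0) + W (Num.max x 0)).
  by apply/funext => x; case: (leP x 0) => _; rewrite W00 ?addr0 ?add0r.
apply: (@measurable_funD _ M R).
  apply: (@nonincreasing_measurable R setT) => // x y xy.
  case: (leP y 0) => [y0|y0]; last by rewrite W00.
  rewrite (min_l (le_trans xy y0)).
  move: xy; rewrite le_eqVlt => /predU1P[->//|xy].
  move: y0; rewrite le_eqVlt => /predU1P[->|y0]; first by rewrite W00.
  exact/ltW/Wdecr.
apply: (@nondecreasing_measurable R setT) => // x y xy.
case: (leP x 0) => [x0|x0]; first by rewrite W00.
rewrite (max_l (le_trans (ltW x0) xy)).
by move: xy; rewrite le_eqVlt => /predU1P[->//|xy]; exact/ltW/Wincr.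
Qed.

(** The integral of [b] is finite and cancels, so the nonnegative [a - b] has integral 0 and
    vanishes almost everywhere. Read contrapositively, a pointwise gain on a non-null set gives a
    strict gain in risk. *)
Lemma negligible_lt_of_integral_le (D : set M) (a b : M -> R) :
  measurable D -> measurable_fun D a -> measurable_fun D b ->
  (forall x, D x -> 0 <= b x) -> (forall x, D x -> b x <= a x) ->
  (\int[mu]_(x in D) (a x)%:E < +oo)%E ->
  (\int[mu]_(x in D) (a x)%:E <= \int[mu]_(x in D) (b x)%:E)%E ->
  mu.-negligible (D `&` [set x | b x < a x]).
Proof.
move=> mD ma mb b0 ba a_fin le_ab.
have mab : measurable_fun D (fun x => (a x - b x)%:E).
  by apply/measurable_EFinP; exact: (@measurable_funB _ M R).
have ab0 x : D x -> (0 <= (a x - b x)%:E)%E.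
  by move=> Dx; rewrite lee_fin subr_ge0 ba.
have E : (\int[mu]_(x in D) (a x)%:E =
    \int[mu]_(x in D) (b x)%:E + \int[mu]_(x in D) (a x - b x)%:E)%E.
  rewrite -ge0_integralD; [|by []|by move=> x Dx; rewrite lee_fin b0|
    exact/measurable_EFinP|exact: ab0|exact: mab].
  by apply: eq_integral => x _; rewrite -EFinD addrC subrK.
have b_ge0 : (0 <= \int[mu]_(x in D) (b x)%:E)%E.
  by apply: integral_ge0 => x Dx; rewrite lee_fin b0.
have ab_ge0 : (0 <= \int[mu]_(x in D) (a x - b x)%:E)%E by exact: integral_ge0.
have b_fin : (\int[mu]_(x in D) (b x)%:E)%E \is a fin_num.
  rewrite ge0_fin_numE//; apply: le_lt_trans a_fin; rewrite E.
  by rewrite leeDl.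
have I0 : (\int[mu]_(x in D) `|(a x - b x)%:E| = 0)%E.
  rewrite (eq_integral (fun x => (a x - b x)%:E)); last first.
    by move=> x; rewrite inE => Dx; rewrite gee0_abs ?ab0.
  apply/eqP; rewrite eq_le ab_ge0 andbT.
  by move: le_ab; rewrite E -[X in (_ <= X)%E]adde0 leeD2lE.
have /ae_eq_integral_abs[//|//|N [mN N0 DN]] := I0.
exists N; split => // x [Dx /= lt_ba]; apply: DN => /= /(_ Dx)[] /eqP.
by rewrite subr_eq0 gt_eqF.
Qed.

Variables (f W : R -> R).
Hypotheses (f_density : is_density f) (W_ge0 : forall x, 0 <= W x) (W_C1 : C1 W).
Hypothesis (W_C3 : C3 f W).
Local Notation G t u := (fun a => \int[mu]_z (W (z - a) * cond_kernel f t u z)).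

Lemma measurable_cond_kernel_pair (t : R) :
  measurable_fun [set: M * M] (fun p : M * M => cond_kernel f t p.2 p.1 : R).
Proof.
have [mf _ _] := f_density.
have mfs (g : M * M -> M) : measurable_fun [set: M * M] g ->
    measurable_fun [set: M * M] (fun p => f (g p) : M).
  exact: (measurableT_comp (f := f : M -> M)).
have m1 : measurable_fun [set: M * M] (fun p : M * M => p.1) by exact: measurable_fst.
have mB : measurable_fun [set: M * M] (fun p : M * M => p.1 - p.2 : M).
  exact: (@measurable_funB _ (M * M)%type R).
apply: (@measurable_funD _ (M * M)%type R); apply: (@measurable_funM _ (M * M)%type R).
- by apply: mfs; apply: (@measurable_funD _ (M * M)%type R).
- exact: mfs.
- exact: mfs.
- by apply: mfs; apply: (@measurable_funD _ (M * M)%type R).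
Qed.

Lemma measurable_loss_kernel_pair (t : R) (g : M -> R) :
  measurable_fun [set: M] g ->
  measurable_fun [set: M * M]
    (fun p : M * M => (W (p.1 - g p.2) * cond_kernel f t p.2 p.1)%:E).
Proof.
move=> mg; apply/measurable_EFinP; apply: (@measurable_funM _ (M * M)%type R).
  apply: (measurableT_comp (measurable_loss W_ge0 W_C1)).
  apply: (@measurable_funB _ (M * M)%type R) => //.
  exact: (measurableT_comp (f := g) mg measurable_snd).
exact: measurable_cond_kernel_pair.
Qed.

Lemma measurable_cond_loss (t : R) (g : M -> R) :
  measurable_fun [set: M] g -> measurable_fun [set: M] (fun u => G t u (g u)).
Proof.
have [_ f0 _] := f_density.
move=> mg; apply: (measurableT_comp (f := fine)) => //.
apply: (measurable_fun_fubini_tonelli_G _ (measurable_loss_kernel_pair t mg)) => p.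
by rewrite lee_fin mulr_ge0// cond_kernel_ge0.
Qed.

(** Integrability from [C3] rules out an infinite value, which [fine] would turn into 0. *)
Lemma cond_loss_EFin (t u a : R) : 0 <= t -> 0 < u ->
  (\int[mu]_z (W (z - a) * cond_kernel f t u z)%:E)%E = (G t u a)%:E.
Proof.
move=> t0 u0; have [iG _ _] := W_C3 a t0 u0.
by rewrite /Rintegral fineK//; exact: integrable_fin_num.
Qed.

(* [m u < a] iff some rational [q < a] has a strictly smaller loss than [a]. *)
Lemma measurable_optimal_shift (m : R -> R) :
  (forall u, 0 < u -> forall a b, m u <= a -> a < b -> G 0 u a < G 0 u b) ->
  (forall u, 0 < u -> forall a b, a < b -> b <= m u -> G 0 u b <= G 0 u a) ->
  measurable_fun pos m.
Proof.
move=> incr decr.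
apply: (measurability (@RGenInftyO.G R)) => [|/= _ [_] [a] -> <-].
  exact: RGenInftyO.measurableE.
have mG r : measurable_fun [set: M] (fun u => G 0 u r) by exact: measurable_cond_loss.
have -> : pos `&` m @^-1` `]-oo, a[ = pos `&` \bigcup_(q : rat)
    (if ratr q < a then (fun u => G 0 u (ratr q) < G 0 u a) @^-1` [set true] else set0).
  apply/seteqP; split => u [] /=; rewrite !in_itv/= andbT => u0.
    move=> ma; split => //; have [q] := rat_in_itvoo ma.
    rewrite in_itv/= => /andP[mq qa]; exists q => //=; rewrite qa.
    exact: incr u0 _ _ (ltW mq) qa.
  move=> [q _]; case: ifP => // qa /= lt_qa; split => //.
  (* If [a <= m u], then [decr] makes the loss at the rational at least the loss at [a]. *)
  by rewrite ltNge; apply/negP => am; move: lt_qa; rewrite ltNge decr.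
apply: measurableI; first exact: measurable_itv.
apply: bigcupT_measurable_rat => q; case: ifP => // _.
rewrite -[X in measurable X]setTI; apply: (measurable_fun_ltr (mG _) (mG _)) => //.
Qed.

Context d (T : measurableType d) (P : R * R -> probability T R) (X1 X2 : {mfun T >-> R}).
Hypothesis (model : location_model f P X1 X2).

Lemma spacing_ge0 (x : R * R) : 0 <= spacing x.
Proof. by rewrite subr_ge0 /pair_min /pair_max ge_min le_max lexx. Qed.

Lemma risk_delta_phi (theta : R * R) (phi : R -> R) :
  measurable_fun (`[0, +oo[ : set R) phi ->
  measurable_fun pos (fun u => G (spacing theta) u (phi u)) /\
  risk P X1 X2 W theta (delta_phi phi) =
  (\int[mu]_(u in pos) (G (spacing theta) u (phi u))%:E)%E.
Proof.
move=> mphi; have [_ f0 _] := f_density.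
(* [phi] is measurable on the half-line only; its extension by 0 is measurable everywhere and agrees
   with it at every spacing. *)
set phi0 := phi \_ (`[0, +oo[ : set R).
have phi0E u : 0 <= u -> phi0 u = phi u.
  by move=> u0; rewrite /phi0 patchE mem_set//= in_itv/= u0.
have mphi0 : measurable_fun [set: M] (phi0 : M -> R).
  by apply/(measurable_restrictT _ (measurable_itv _)).
split.
  apply: (eq_measurable_fun (fun u => G (spacing theta) u (phi0 u))).
    by move=> u; rewrite inE/= in_itv/= andbT => u0; rewrite phi0E// ltW.
  by apply: measurable_funTS; exact: measurable_cond_loss.
rewrite /risk unlock.
have mh : measurable_fun [set: M * M] (fun p : M * M => (W (p.1 - phi0 p.2))%:E).
  apply/measurable_EFinP; apply: (measurableT_comp (measurable_loss W_ge0 W_C1)).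
  apply: (@measurable_funB _ (M * M)%type R) => //.
  exact: (measurableT_comp (f := phi0) mphi0 measurable_snd).
transitivity (\int[mu]_(u in pos) \int[mu]_z
    ((W (z - phi0 u))%:E * (cond_kernel f (spacing theta) u z)%:E))%E.
  rewrite -(integral_location_spacing theta f_density model mh)/=; last first.
    by move=> p; rewrite lee_fin.
  apply: eq_integral => w _; rewrite phi0E ?spacing_ge0// /delta_phi.
  by congr (W _)%:E; ring.
apply: eq_integral => u; rewrite inE/= in_itv/= andbT => u0.
by rewrite phi0E ?ltW// -cond_loss_EFin ?spacing_ge0//.
Qed.

(** The probability is the integral of an indicator, and its inner integral vanishes for [u] outside
    [S]. A spacing equal to 0 has probability 0, so only the positive part of [S] counts. *)
Lemma probability_spacing_eq0 (theta : R * R) (S : set R) :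
  measurable (S : set M) -> mu.-negligible (pos `&` S) ->
  P theta [set w | S (spacing (X1 w, X2 w))] = 0%E.
Proof.
move=> mS [N [mN N0 SN]]; have [_ f0 _] := f_density.
pose g : M -> R := \1_(S : set M).
have mg : measurable_fun [set: M] g by exact: measurable_indic.
have g0 u : 0 <= g u by rewrite /g indicE.
have mh : measurable_fun [set: M * M] (fun p : M * M => (g p.2)%:E : \bar R).
  by apply/measurable_EFinP; exact: (measurableT_comp (f := g) mg measurable_snd).
have h0 (p : R * R) : (0 <= (g p.2)%:E :> \bar R)%E by rewrite lee_fin.
have mspacing : measurable_fun [set: T] (fun w => spacing (X1 w, X2 w)).
  apply: measurable_funB; first exact: measurable_maxr.
  exact: measurable_minr.
have mE : measurable [set w | S (spacing (X1 w, X2 w))].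
  by rewrite -[X in measurable X]setTI; exact: mspacing.
have mK : measurable_fun [set: M] (fun u =>
    \int[mu]_z ((g u)%:E * (cond_kernel f (spacing theta) u z)%:E))%E.
  have mF : measurable_fun [set: M * M] (fun p : M * M =>
      ((g p.2)%:E * (cond_kernel f (spacing theta) p.2 p.1)%:E)%E).
    apply: emeasurable_funM => //; apply/measurable_EFinP.
    exact: measurable_cond_kernel_pair.
  apply: (measurable_fun_fubini_tonelli_G _ mF) => p.
  by rewrite mule_ge0// lee_fin ?g0// cond_kernel_ge0.
rewrite -[X in P _ X]setIT -integral_indic//.
have := integral_location_spacing theta f_density model mh h0.
rewrite /= => E; rewrite [LHS]E.
transitivity (\int[mu]_(u in pos) cst 0 u)%E; last exact: integral0.
apply: ge0_ae_eq_integral => //.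
- exact: measurable_funTS.
- by move=> u _; apply: integral_ge0 => z _; rewrite mule_ge0// lee_fin ?g0// cond_kernel_ge0.
exists N; split => // u /= /not_implyP[u0 uE]; apply: SN; split => //.
apply: contrapT => Su; apply: uE; apply: integral0_eq => z _.
by rewrite /g indicE memNset// mul0e.
Qed.

End Risk.

(** * Comparison of the two risks *)

Theorem theorem2p1 (R : realType) (d : measure_display) (T : measurableType d)
    (f W : R -> R) (P : R * R -> probability T R) (X1 X2 : {mfun T >-> R})
    (c : R -> R -> R)
    (f_density : is_density f)
    (model : location_model f P X1 X2)
    (f_MLR : MLR f)
    (W_ge0 : forall x, 0 <= W x)
    (W_C1 : C1 W) (W_C2 : C2 W) (W_C3 : C3 f W)
    (c_min : forall t u : R, 0 <= t -> 0 < u ->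
      unique_minimizer (cond_risk f W t u) (c t u))
    (c_zero : forall t u : R, 0 <= t -> 0 < u ->
      unique_zero (fun a : R =>
        \int[@lebesgue_measure R]_z (derive1 W (z - a) * cond_kernel f t u z))
        (c t u)) :
  (forall u : R, 0 < u ->
     unique_zero (fun a : R =>
       \int[@lebesgue_measure R]_z (derive1 W (z - a) * (f (z - u) * f z)))
       (c 0 u)) /\
  (forall phi : R -> R,
     measurable_fun (`[0, +oo[ : set R) phi ->
     finite_risk P X1 X2 W (delta_phi phi) ->
     (exists theta : R * R,
        (0 < P theta [set w | c 0 (spacing (X1 w, X2 w))
                              < phi (spacing (X1 w, X2 w))]%R)%E) ->
     improves_upon P X1 X2 W
       (delta_phi (fun u => Num.min (phi u) (c 0 u)))
       (delta_phi phi)).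
Proof.
have [_ f0 _] := f_density.
split=> [u u0|phi mphi phi_fin [theta Pgt]].
  have [Hc uniq] := c_zero 0 u (lexx 0) u0.
  (* At [t = 0] the two summands of the kernel coincide, whence the factor [2^-1]. *)
  have E a : \int[@lebesgue_measure R]_z (derive1 W (z - a) * (f (z - u) * f z)) =
      2^-1 * \int[@lebesgue_measure R]_z (derive1 W (z - a) * cond_kernel f 0 u z).
    have [_ ia _] := W_C3 0 u a (lexx 0) u0.
    rewrite -RintegralZl//; apply: eq_Rintegral => z _.
    by rewrite /cond_kernel !addr0; field.
  split; first by rewrite E Hc mulr0.
  by move=> y; rewrite E => /eqP; rewrite mulf_eq0 invr_eq0 pnatr_eq0/= => /eqP/uniq.
have c_mono t u : 0 <= t -> 0 < u -> c t u <= c 0 u.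
  move=> t0 u0; have := c_min t u t0 u0; have := c_min 0 u (lexx 0) u0.
  move=> min0 mint.
  exact: (optimal_shift_le f_density W_C2 W_C3 f_MLR t0 u0 mint min0
    (c_zero t u t0 u0) (c_zero 0 u (lexx 0) u0)).
have mc : measurable_fun (`[0, +oo[ : set R) (c 0).
  (* Adding the endpoint 0 to the domain preserves measurability, whatever the value [c 0 0]. *)
  apply/measurable_fun_itv_obnd_cbndP; apply: (measurable_optimal_shift f_density W_ge0 W_C1).
    move=> u u0 a b ma ab.
    exact: (cond_loss_increasing f_density W_C2 W_C3 (lexx 0) u0 (c_zero 0 u (lexx 0) u0)).
  move=> u u0 a b ab bm.
  exact: (cond_loss_nonincreasing f_density W_C2 W_C3 (lexx 0) u0 (c_zero 0 u (lexx 0) u0)).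
set phi0 := fun u => Num.min (phi u) (c 0 u).
have mphi0 : measurable_fun (`[0, +oo[ : set R) phi0 by exact: measurable_minr.
have G_ge0 t u a : 0 <= \int[@lebesgue_measure R]_z (W (z - a) * cond_kernel f t u z).
  by apply: Rintegral_ge0 => z _; rewrite mulr_ge0 ?cond_kernel_ge0.
have lt_G t u : 0 <= t -> 0 < u -> c 0 u < phi u ->
    \int[@lebesgue_measure R]_z (W (z - phi0 u) * cond_kernel f t u z) <
    \int[@lebesgue_measure R]_z (W (z - phi u) * cond_kernel f t u z).
  move=> t0 u0 lt_c; rewrite /phi0 (min_r (ltW lt_c)).
  exact: (cond_loss_increasing f_density W_C2 W_C3 t0 u0 (c_zero t u t0 u0) (c_mono t u t0 u0)).
have le_G t u : 0 <= t -> 0 < u ->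
    \int[@lebesgue_measure R]_z (W (z - phi0 u) * cond_kernel f t u z) <=
    \int[@lebesgue_measure R]_z (W (z - phi u) * cond_kernel f t u z).
  move=> t0 u0; have [le_c|/(lt_G t u t0 u0)/ltW//] := leP (phi u) (c 0 u).
  by rewrite /phi0 (min_l le_c).
have risk_phi tau := risk_delta_phi f_density W_ge0 W_C1 W_C3 model tau mphi.
have risk_phi0 tau := risk_delta_phi f_density W_ge0 W_C1 W_C3 model tau mphi0.
have le_risk tau : (risk P X1 X2 W tau (delta_phi phi0) <= risk P X1 X2 W tau (delta_phi phi))%E.
  have [m1 ->] := risk_phi tau; have [m0 ->] := risk_phi0 tau.
  apply: ge0_le_integral; first exact: measurable_itv.
  - by move=> u _; rewrite lee_fin.
  - exact/measurable_EFinP.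
  - exact/measurable_EFinP.
  - move=> u; rewrite /= in_itv/= andbT => u0.
    by rewrite lee_fin le_G// spacing_ge0.
(* The given [theta] already shows strict inequality. Otherwise, the risk of [delta_phi phi] being
   finite, the set of [u > 0] with [c 0 u < phi u] would be null, and the event in [Pgt] would have
   probability 0. *)
split=> //; exists theta; rewrite ltNge; apply/negP => ge_risk.
move: Pgt; rewrite lt0e => /andP[/eqP + _]; apply.
(* The half-line is kept in [S] because [c 0] and [phi] are known to be measurable only there;
   spacings never leave it. *)
pose S := (`[0, +oo[ : set R) `&` [set u | c 0 u < phi u].
have mS : measurable (S : set (measurableTypeR R)).
  have -> : S = (`[0, +oo[ : set R) `&` (fun u => c 0 u < phi u) @^-1` [set true] by [].
  by apply: (measurable_fun_ltr mc mphi) => //; exact: measurable_itv.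
rewrite (_ : [set w | _] = [set w | S (spacing (X1 w, X2 w))]); last first.
  apply/seteqP; split => w /=; last by case.
  by move=> ?; split => //=; rewrite in_itv/= spacing_ge0.
apply: (probability_spacing_eq0 f_density model theta mS).
have [m1 E1] := risk_phi theta; have [m0 E0] := risk_phi0 theta.
have := negligible_lt_of_integral_le (measurable_itv _) m1 m0.
rewrite -E1 -E0 => neg.
apply: negligibleS (neg _ _ (phi_fin theta) ge_risk) => //.
- move=> u [u0 [_ /= lt_c]]; split => //=.
  by move: u0; rewrite /= in_itv/= andbT => u0; rewrite lt_G// spacing_ge0.
- by move=> u; rewrite /= in_itv/= andbT => u0; rewrite le_G// spacing_ge0.
Qed.
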